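(* Let $L=(L,\wedge,\vee,1,0)$ be a complete lattice and $X\subseteq L\setminus\{1\}$ a subset such that $L$ is an $X$-top lattice, and equip $X$ with its Zariski-like topology. The following are equivalent: (1) $X$ is discrete; (2) every $x\in X$ is minimal in $X$ and completely strongly $X$-irreducible; (3) $X$ is PAMin, i.e. every $x\in X$ is absolutely $X$-minimal; (4) every $x\in X$ is maximal in $X$ and $X$ is BMax; (5) $X$ is PBMax, i.e. every $x\in X$ is barely $X$-maximal; (6) $X$ is $T_1$ and $X$ is BMax; (7) $X$ is $T_1$ and $C^X(L)$ has the complete max-property. In this case, $AMin(X)=\mathrm{Min}(X)=X=\mathrm{Max}(X)=BMax(X)$.
   Context: For a complete lattice $L=(L,\wedge,\vee,1,0)$, $X\subseteq L\setminus\{1\}$ and $a\in L$, put $V(a)=\{x\in X: a\le x\}$ and $D(a)=X\setminus V(a)$. $L$ is an $X$-top lattice iff the family $\{V(a):a\in L\}$ is closed under finite unions (it always contains $X=V(0)$, $\emptyset=V(1)$ and is closed under arbitrary intersections); then the sets $D(a)$, $a\in L$, are the open sets of a topology on $X$, called the Zariski-like topology. $X$ is a poset with the order of $L$; $\mathrm{Max}(X)$, $\mathrm{Min}(X)$ are its sets of maximal and minimal elements. All meets are taken in $L$ and the empty meet is $1$. $C^X(L)=\{a\in L: a=\bigwedge_{y\in V(a)}y\}$. $q\in X$ is completely strongly $X$-irreducible iff for every $A\subseteq X$, $\bigwedge_{a\in A}a\le q$ implies $a\le q$ for some $a\in A$. $q\in X$ is absolutely $X$-minimal iff $q\in\mathrm{Min}(X)$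 and $\bigwedge_{a\in \mathrm{Min}(X)\setminus\{q\}}a\not\le q$; $AMin(X)$ is the set of such $q$. $q\in X$ is barely $X$-maximal iff $q\in\mathrm{Max}(X)$ and $\bigwedge_{a\in \mathrm{Max}(X)\setminus\{q\}}a\not\le q$; $BMax(X)$ is the set of such $q$. $X$ is BMax iff $\mathrm{Max}(X)=BMax(X)$; PAMin iff $X=AMin(X)$; PBMax iff $X=BMax(X)$. $C^X(L)$ has the complete max-property iff, with $M$ the set of maximal elements of $C^X(L)\setminus\{1\}$, one has $\bigwedge_{a\in M\setminus\{q\}}a\not\le q$ for every $q\in M$. *)

(* Defs.v *)
From HB Require Import structures.
From mathcomp Require Import all_boot all_order.
From mathcomp Require Import all_classical topology_structure discrete_topology.
From mathcomp Require Import separation_axioms.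

Set Implicit Arguments.
Unset Strict Implicit.
Unset Printing Implicit Defensive.

Import Order.TTheory.
Local Open Scope classical_set_scope.
Local Open Scope order_scope.

Definition complete_lattice d (L : tbLatticeType d) : Prop :=
  forall A : set L, infimums A !=set0 /\ supremums A !=set0.

(* [infimum \top set0] is [\top]: the empty meet is the top element. On an [A]
   without infimum the value is a default, see [Meet_infimums]. *)
Definition Meet d (L : tbLatticeType d) (A : set L) : L := infimum \top A.

Lemma Meet_infimums d (L : tbLatticeType d) (A : set L) :
  complete_lattice L -> infimums A (Meet A).
Proof.
move=> /(_ A)[[m mA] _]; rewrite /Meet /infimum; case: ifPn => [/eqP ->|_].
  by split=> [x []|x _]; exact: lex1.
by case: xgetP => [y _ //|/(_ m)].
Qed.

Section XTop.
Context d (L : tbLatticeType d).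
Implicit Types (X A : set L) (a q : L).

Definition V X a : set L := [set x | X x /\ a <= x].
Definition D X a : set L := X `\` V X a.

(* The empty union needs no clause: it is [V X \top] as soon as [\top] is not
   in [X]. *)
Definition X_top_lattice X : Prop := setU_closed (range (V X)).

Definition Max A : set L := [set x | A x /\ forall y, A y -> x <= y -> y = x].
Definition Min A : set L := [set x | A x /\ forall y, A y -> y <= x -> y = x].

Definition completely_strongly_irreducible X q : Prop :=
  X q /\ forall A, A `<=` X -> Meet A <= q -> exists2 a, A a & a <= q.

Definition AMin X : set L :=
  [set q | Min X q /\ ~ (Meet (Min X `\ q) <= q)].
Definition BMax X : set L :=
  [set q | Max X q /\ ~ (Meet (Max X `\ q) <= q)].

Definition is_BMax X : Prop := Max X = BMax X.
Definition is_PAMin X : Prop := X = AMin X.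
Definition is_PBMax X : Prop := X = BMax X.

Definition CX X : set L := [set a | a = Meet (V X a)].

Definition complete_max_property (C : set L) : Prop :=
  let M := Max (C `\ \top) in forall q, M q -> ~ (Meet (M `\ q) <= q).

End XTop.

(* The type of points of [X], with the Zariski-like topology. The hypotheses are
   parameters of the type because the axioms of a topology depend on them. *)
Definition zariski d (L : tbLatticeType d) (X : set L)
  (hL : complete_lattice L) (hX1 : X `<=` [set~ \top])
  (hX : X_top_lattice X) : Type := set_type X.

Section Zariski.
Context d (L : tbLatticeType d) (X : set L).
Context (hL : complete_lattice L) (hX1 : X `<=` [set~ \top]).
Context (hX : X_top_lattice X).
Local Notation Z := (zariski hL hX1 hX).

HB.instance Definition _ := Choice.copy Z (set_type X).

Definition zariski_open : set_system Z :=
  [set [set x : Z | D X a (val x)] | a in [set: L]].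

Let DE a (x : Z) : D X a (val x) <-> ~ (a <= val x).
Proof.
have Xx : X (val x) by exact/set_mem/(valP x).
by split=> [[_ nV] ax|nax]; [apply: nV | split=> // -[_ /nax]].
Qed.

Let openT : zariski_open setT.
Proof.
exists \top => //; rewrite predeqE => x; split=> // _; apply/DE.
have /hX1 x1 : X (val x) by exact/set_mem/(valP x).
by move=> tx; apply: x1; apply/le_anti; rewrite lex1.
Qed.

Let openI : setI_closed zariski_open.
Proof.
move=> _ _ [a _ <-] [b _ <-].
have [c _ Vc] : range (V X) (V X a `|` V X b).
  by apply: hX; [exists a | exists b].
by exists c => //; rewrite predeqE => x /=; rewrite /D Vc setDUr.
Qed.

Let open_bigU (I : Type) (f : I -> set Z) :
  (forall i, zariski_open (f i)) -> zariski_open (\bigcup_i f i).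
Proof.
move=> of_.
pose A := [set a | exists i, [set x : Z | D X a (val x)] = f i].
have [_ [s [sA As]]] := hL A.
exists s => //; rewrite predeqE => x; split=> [/DE nsx|[i _]].
  apply: contrapT => nfx; apply: nsx; apply: As => a [i fi].
  apply: contrapT => nax; apply: nfx; exists i => //.
  by rewrite -fi; exact/DE.
have [a _ fi] := of_ i; rewrite -fi => /DE nax; apply/DE => sx; apply: nax.
by apply: le_trans sx; apply: sA; exists i.
Qed.

HB.instance Definition _ :=
  isOpenTopological.Build Z openT openI open_bigU.

Lemma open_zariskiE (U : set Z) :
  open U <-> exists a, U = [set x : Z | D X a (val x)].
Proof. by split=> [[a _ <-]|[a ->]]; exists a. Qed.

End Zariski.

Definition discrete_space (T : topologicalType) : Prop :=
  forall A : set T, open A.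

Lemma discrete_space_nbhsE (T : topologicalType) :
  discrete_space T <-> @nbhs T T = principal_filter.
Proof.
split=> [dT|nT A]; last first.
  by rewrite openE => x Ax; rewrite /interior nT; exact/principal_filterP.
apply/funext => x; apply/seteqP; split=> A.
  by move=> /nbhs_singleton Ax; exact/principal_filterP.
by move=> /principal_filterP Ax; apply: open_nbhs_nbhs; split=> //; exact: dT.
Qed.

(* Main.v *)
(** Every condition says that [X] is irredundant: no [x] in [X] lies above the
    meet of the other elements of [X]. An irredundant [X] is an antichain, so
    [Min X = X = Max X], and each subset [A] of [X] is the open set [D X a] for
    [a] the meet of [X `\` A]. Conversely, an open singleton [D X a = [set x]]
    has [a] below all the other elements of [X] but not below [x]. The T1 axiom
    says that [X] is an antichain, and the maximal elements of [CX X] other than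
    [\top] are those of [X], so the complete max-property of [CX X] is the BMax
    condition on [X]. *)
Require Import Defs.
From mathcomp Require Import all_boot all_order.
From mathcomp Require Import all_classical topology_structure discrete_topology.
From mathcomp Require Import separation_axioms.

Import Order.TTheory.
Local Open Scope classical_set_scope.
Local Open Scope order_scope.

Section Irredundant.
Set Implicit Arguments.
Unset Strict Implicit.
Context (d : Order.disp_t) (L : tbLatticeType d).
Context (hL : complete_lattice L).
Implicit Types (X A B : set L) (a x : L).

Definition irredundant X := forall x, X x -> ~ Meet (X `\ x) <= x.
Definition antichain X := forall x y, X x -> X y -> x <= y -> x = y.

Lemma Meet_le A x : A x -> Meet A <= x.
Proof. by have [lbA _] := Meet_infimums A hL; exact: lbA. Qed.

Lemma le_Meet A a : (forall x, A x -> a <= x) -> a <= Meet A.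
Proof. by have [_ ubA] := Meet_infimums A hL; exact: ubA. Qed.

Lemma Meet_subset A B : A `<=` B -> Meet B <= Meet A.
Proof. by move=> AB; apply: le_Meet => x /AB; exact: Meet_le. Qed.

Lemma irredundant_antichain X : irredundant X -> antichain X.
Proof.
move=> irrX x y Xx Xy xy; apply: contrapT => xNy; apply: (irrX y Xy).
by apply: le_trans xy; apply: Meet_le.
Qed.

Lemma antichain_Min X : antichain X -> Min X = X.
Proof.
move=> acX; apply/seteqP; split=> [x []//|x Xx]; split=> // y Xy.
exact: acX.
Qed.

Lemma antichain_Max X : antichain X -> Max X = X.
Proof.
move=> acX; apply/seteqP; split=> [x []//|x Xx]; split=> // y Xy xy.
exact/esym/acX.
Qed.

(** Since [AMin X] lies inside [Min X], the equality [X = AMin X] forces [Min X = X], and the meet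
    over the other minimal elements becomes the meet over the rest of [X]. *)
Lemma is_PAMin_irredundant X : is_PAMin X <-> irredundant X.
Proof.
split=> [XA|irrX].
  have MinX : Min X = X.
    by apply/seteqP; split=> [x []//|x]; rewrite {1}XA => -[].
  by move=> x; rewrite {1}XA => -[_]; rewrite MinX.
rewrite /is_PAMin /AMin (antichain_Min (irredundant_antichain irrX)).
by apply/seteqP; split=> [x Xx|x []//]; split=> //; exact: irrX.
Qed.

Lemma is_BMaxP X :
  is_BMax X <-> forall x, Max X x -> ~ Meet (Max X `\ x) <= x.
Proof.
split=> [MB x|irrM]; first by rewrite {1}MB => -[].
by apply/seteqP; split=> [x Mx|x []//]; split=> //; exact: irrM.
Qed.

Lemma is_PBMax_irredundant X : is_PBMax X <-> irredundant X.
Proof.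
split=> [XB|irrX].
  have MaxX : Max X = X.
    by apply/seteqP; split=> [x []//|x]; rewrite {1}XB => -[].
  by move=> x; rewrite {1}XB => -[_]; rewrite MaxX.
rewrite /is_PBMax /BMax (antichain_Max (irredundant_antichain irrX)).
by apply/seteqP; split=> [x Xx|x []//]; split=> //; exact: irrX.
Qed.

Lemma is_BMax_irredundant X : Max X = X -> is_BMax X <-> irredundant X.
Proof. by move=> MaxX; rewrite is_BMaxP MaxX. Qed.

Lemma Min_irreducible_irredundant X :
  (forall x, X x -> Min X x /\ completely_strongly_irreducible X x) <->
  irredundant X.
Proof.
split=> [irrX x Xx Mx|irrX x Xx].
  have [[_ minx] [_ irrx]] := irrX x Xx.
  (* Irreducibility yields an element other than [x] below [x], against minimality. *)
  have [|a [Xa ax] ax'] := irrx (X `\ x) _ Mx; first by move=> y [].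
  by apply: ax; exact: minx.
split; first by rewrite (antichain_Min (irredundant_antichain irrX)).
split=> // A AX Ax; exists x => //; apply: contrapT => nAx.
apply: (irrX x Xx); apply: le_trans Ax; apply: Meet_subset => y Ay.
by split; [exact: AX | move=> yx; apply: nAx; rewrite -yx].
Qed.

Lemma CX_subset X : X `<=` CX X.
Proof.
move=> x Xx; apply/le_anti/andP; split; first by apply: le_Meet => y [].
by apply: Meet_le; split.
Qed.

(** If nothing in [X] were above [a], then [a] would be the empty meet, that is [\top]. *)
Lemma CX_neq_top X a : CX X a -> a <> \top -> exists2 x, X x & a <= x.
Proof.
move=> CXa a1; apply: contrapT => nx; apply: a1; apply/le_anti.
rewrite lex1 /= CXa; apply: le_Meet => x [Xx ax].
by exfalso; apply: nx; exists x.
Qed.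

Lemma Max_CX X : X `<=` [set~ \top] -> Max (CX X `\ \top) = Max X.
Proof.
move=> X1; have XC x : X x -> (CX X `\ \top) x.
  by move=> Xx; split; [exact: CX_subset | exact: X1].
apply/seteqP; split=> a.
  move=> [[CXa a1] maxa]; have [x Xx ax] := CX_neq_top CXa a1.
  have xa := maxa x (XC x Xx) ax; rewrite -xa in maxa *.
  by split=> // y Xy; exact: maxa (XC y Xy).
move=> [Xa maxa]; split=> [|b [CXb b1] ab]; first exact: XC.
have [x Xx bx] := CX_neq_top CXb b1.
have xa := maxa x Xx (le_trans ab bx).
by apply/le_anti; rewrite ab andbT -xa.
Qed.

Lemma complete_max_property_is_BMax X : X `<=` [set~ \top] ->
  complete_max_property (CX X) <-> is_BMax X.
Proof. by move=> X1; rewrite is_BMaxP /complete_max_property Max_CX. Qed.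

Section Zariski.
Context (X : set L) (hX1 : X `<=` [set~ \top]) (hX : X_top_lattice X).
Local Notation Z := (zariski hL hX1 hX).

Lemma zariski_point x : X x -> exists z : Z, val z = x.
Proof. by move=> /mem_set Xx; exists (exist _ x Xx). Qed.

Lemma zariski_mem (z : Z) : X (val z).
Proof. exact/set_mem/(valP z). Qed.

Lemma discrete_irredundant : discrete_space Z <-> irredundant X.
Proof.
split=> [dZ x Xx|irrX A].
  have [z zx] := zariski_point Xx.
  have /open_zariskiE[a za] := dZ [set z].
  have : [set z] z by [].
  rewrite za /= zx => -[_ nax] Mx; apply: nax; split=> //.
  apply: le_trans Mx; apply: le_Meet => y [Xy yx].
  have [w wy] := zariski_point Xy.
  (* Otherwise [w] would lie in the open set cut out by [a], which is the singleton of [z]. *)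
  apply: contrapT => nay; apply: yx.
  have : [set z] w by rewrite za /= wy; split=> // -[].
  by move=> /= wz; rewrite -wy wz.
apply/open_zariskiE.
(* The complement of [A] has to be described inside [L], as [A] is a set of points of [Z]. *)
exists (Meet [set x | X x /\ forall z : Z, val z = x -> ~ A z]).
apply/seteqP; split=> z /=.
  move=> Az; have Xz := zariski_mem z; split=> // -[_ Mz].
  apply: (irrX _ Xz); apply: le_trans Mz; apply: Meet_subset => y [Xy nAy].
  by split=> // yz; exact: (nAy z).
move=> [Xz nV]; apply: contrapT => nAz; apply: nV; split=> //.
by apply: Meet_le; split=> // w /val_inj ->.
Qed.

(** Each open set [D X a] is downward closed, so no open set contains the larger of two comparable
    points without the smaller. In an antichain, [D X (val w)] omits only [w]. *)
Lemma accessible_antichain : accessible_space Z <-> antichain X.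
Proof.
split=> [T1 x y Xx Xy xy|acX z w zw].
  apply: contrapT => nxy.
  have [[z zx] [w wy]] := (zariski_point Xx, zariski_point Xy).
  have [|U [/open_zariskiE[a ->]]] := T1 w z.
    by apply/eqP => wz; apply: nxy; rewrite -zx -wz wy.
  move=> /set_mem /= + /set_mem /=; rewrite zx wy => -[_ nay] nDx.
  apply: nay; split=> //.
  apply: le_trans xy; apply: contrapT => nax; apply: nDx.
  by split=> // -[].
have [Xz Xw] := (zariski_mem z, zariski_mem w).
exists [set u : Z | D X (val w) (val u)]; split.
- by apply/open_zariskiE; exists (val w).
- apply/mem_set; split=> // -[_ wz]; move/eqP: zw; apply; apply: val_inj.
  exact/esym/acX.
- by apply/mem_set => -[_]; apply; split.
Qed.

End Zariski.
End Irredundant.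

Theorem theorem2p17 (d : Order.disp_t) (L : tbLatticeType d) (X : set L)
  (hL : complete_lattice L) (hX1 : X `<=` [set~ \top])
  (hX : X_top_lattice X) :
  [<-> discrete_space (zariski hL hX1 hX);
       forall x : L, X x -> Min X x /\ completely_strongly_irreducible X x;
       is_PAMin X;
       (forall x : L, X x -> Max X x) /\ is_BMax X;
       is_PBMax X;
       accessible_space (zariski hL hX1 hX) /\ is_BMax X;
       accessible_space (zariski hL hX1 hX) /\ complete_max_property (CX X)]
  /\ (discrete_space (zariski hL hX1 hX) ->
      [/\ AMin X = Min X, Min X = X, X = Max X & Max X = BMax X]).
Proof.
(* After these rewrites only the implications that involve [Max X] or the antichain condition need
   an argument. *)
rewrite (propext (discrete_irredundant hL hX1 hX)).
rewrite (propext (accessible_antichain hL hX1 hX)).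
rewrite (propext (Min_irreducible_irredundant hL X)).
rewrite (propext (is_PAMin_irredundant hL X)).
rewrite (propext (is_PBMax_irredundant hL X)).
rewrite (propext (complete_max_property_is_BMax hL hX1)).
split.
  tfae => // [irrX|[XM BX]|irrX|[acX BX]].
  - have MaxX := antichain_Max (irredundant_antichain hL irrX).
    by split; [rewrite MaxX | exact/is_BMax_irredundant].
  - have MaxX : Max X = X by apply/seteqP; split=> [x []|].
    exact/(is_BMax_irredundant MaxX).
  - have acX := irredundant_antichain hL irrX; split=> //.
    exact/(is_BMax_irredundant (antichain_Max acX)).
  - exact/(is_BMax_irredundant (antichain_Max acX)).
move=> irrX; have acX := irredundant_antichain hL irrX.
split.
- by rewrite antichain_Min //; exact/esym/(is_PAMin_irredundant hL).
- exact: antichain_Min.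
- exact/esym/antichain_Max.
- exact/(is_BMax_irredundant (antichain_Max acX)).
Qed.
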